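(* Let $k,\hat n,\tilde n\ge1$ be integers, let $n=\hat n\cdot\tilde n$, and let $B\in\mathbb{R}^{n\times n}$ be symmetric positive semi-definite. Let $\tilde x_1,\ldots,\tilde x_k$ (with values in $\mathbb{R}^{\tilde n}$) and $\hat x_1,\ldots,\hat x_k$ (with values in $\mathbb{R}^{\hat n}$) be $2k$ independent random vectors that are either all standard Gaussian vectors or all Rademacher vectors, and let $$\mathsf{Est}_k=\frac1k\sum_{i=1}^k(\tilde x_i\otimes\hat x_i)^TB(\tilde x_i\otimes\hat x_i).$$ Let $0<\varepsilon<1$. Then the bound $$\operatorname{trace}(B)\le\frac{1}{1-\varepsilon}\,\mathsf{Est}_k$$ holds with probability at least $1-\exp(-k\varepsilon^2/18)$.
   Context: $\otimes$ denotes the Kronecker product. A standard Gaussian vector of length $d$ has distribution $\mathcal{N}(0,I_d)$. A Rademacher vector is a random vector whose entries are independent and take the values $1$ and $-1$, each with probability $1/2$. *)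

(* Defs.v *)
From HB Require Import structures.
From mathcomp Require Import all_boot all_order all_algebra.
From mathcomp Require Import all_classical all_reals all_analysis.
From mathcomp Require Import mxtens.

Set Implicit Arguments.
Unset Strict Implicit.
Unset Printing Implicit Defensive.

Import Order.TTheory GRing.Theory Num.Theory.
Import numFieldNormedType.Exports.

Local Open Scope classical_set_scope.
Local Open Scope ring_scope.

Definition psd {R : realType} {n : nat} (B : 'M[R]_n) : Prop :=
  B^T = B /\ forall x : 'cV[R]_n, 0 <= (x^T *m B *m x) 0 0.

Definition independent {d : measure_display} {T : measurableType d}
    {R : realType} (P : probability T R) {I : finType}
    (F : I -> set (set T)) : Prop :=
  forall (J : {set I}) (E : I -> set T),
    (forall i, i \in J -> F i (E i)) ->
    P (\bigcap_(i in [set` J]) E i) = (\prod_(i in J) P (E i))%E.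

(* n.-tuple R carries the product of the Borel sigma-algebras, so a random
   vector of length n is a random variable {RV P >-> n.-tuple R}. *)
Definition entry {T : Type} {R : Type} {n : nat} (X : T -> n.-tuple R)
    (j : 'I_n) : T -> R :=
  fun w => tnth (X w) j.

Definition independent_entries {d : measure_display} {T : measurableType d}
    {R : realType} (P : probability T R) {n : nat} (X : {RV P >-> n.-tuple R})
    : Prop :=
  independent P (fun j : 'I_n => g_sigma_algebra_preimage (entry X j)).

(* N(0, I_n) is the n-fold product of N(0, 1): independent standard normal
   entries. *)
Definition standard_gaussian {d : measure_display} {T : measurableType d}
    {R : realType} (P : probability T R) {n : nat} (X : {RV P >-> n.-tuple R})
    : Prop :=
  independent_entries X /\
  forall (j : 'I_n) (A : set R), measurable A ->
    pushforward P (entry X j) A = normal_prob 0 1 A.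

Definition rademacher {d : measure_display} {T : measurableType d}
    {R : realType} (P : probability T R) {n : nat} (X : {RV P >-> n.-tuple R})
    : Prop :=
  independent_entries X /\
  forall j : 'I_n,
    P [set w | entry X j w = 1] = (2^-1)%:E /\
    P [set w | entry X j w = - 1] = (2^-1)%:E.

Definition jointly_independent {d : measure_display} {T : measurableType d}
    {R : realType} (P : probability T R) {k m n : nat}
    (X : 'I_k -> {RV P >-> m.-tuple R}) (Y : 'I_k -> {RV P >-> n.-tuple R})
    : Prop :=
  independent P (fun s : 'I_k + 'I_k =>
    match s with
    | inl i => g_sigma_algebra_preimage (X i)
    | inr i => g_sigma_algebra_preimage (Y i)
    end).

Definition cvec {R : realType} {n : nat} (t : n.-tuple R) : 'cV[R]_n :=
  \col_j tnth t j.

(* tensmx returns a matrix with 1 * 1 columns, which is convertible to 1. *)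
Definition kron {R : realType} {m n : nat} (u : 'cV[R]_m) (v : 'cV[R]_n)
    : 'cV[R]_(m * n) :=
  tensmx u v.

Definition Est {T : Type} {R : realType} {k m n : nat} (B : 'M[R]_(m * n))
    (X : 'I_k -> T -> m.-tuple R) (Y : 'I_k -> T -> n.-tuple R) (w : T) : R :=
  k%:R^-1 * \sum_(i < k)
    ((kron (cvec (X i w)) (cvec (Y i w)))^T *m B
       *m kron (cvec (X i w)) (cvec (Y i w))) 0 0.

(* Main.v *)
Require Import Defs.
From HB Require Import structures.
From mathcomp Require Import all_boot all_order all_algebra.
From mathcomp Require Import all_classical all_reals all_analysis.
From mathcomp Require Import finmap measurable_realfun mxtens ring lra.

(** Each summand of the estimator is a nonnegative variable
    Q = (x (x) y)^T B (x (x) y) whose mean is the trace tau of B.  For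
    nonnegative variables the lower tail needs only two moments: since
    exp (- u) <= 1 - u + u ^ 2 / 2 for u >= 0, the bound E [Q ^ 2] <= 9 tau ^ 2
    gives E [exp (- t Q)] <= exp (- t tau + 9 t ^ 2 tau ^ 2 / 2) for t >= 0.
    Multiplying over the k independent summands and applying Markov's
    inequality with t = eps / (9 tau) yields exp (- k eps ^ 2 / 18); this is
    [lower_tail].

    The second moment is bounded by conditioning.  For fixed y, Q is the
    quadratic form in x of the positive semi-definite matrix [slice B y], whose
    trace is the quadratic form in y of the partial trace [ptrace B].  For a
    vector with independent centred entries of variance 1 and fourth moment
    kappa <= 3 (3 for Gaussian entries, 1 for random signs), Wick's formula gives
      E [(x^T A x) ^ 2] = tr(A) ^ 2 + 2 sum A_ij ^ 2 + (kappa - 3) sum A_ii ^ 2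
    for A symmetric, which is at most 3 tr(A) ^ 2 because
    A_ij ^ 2 <= A_ii A_jj for A positive semi-definite ([sum_wick4_le]).  Using
    this once for x and once for y gives the constant 3 * 3 = 9
    ([kron_form_sqr_has_mean]).

    The probabilistic input is that means of products factor over independent
    families ([independent_has_mean_prod]).  It is used for the entries of one
    vector, for the two vectors of one summand, and for the k summands; in the
    last case the independence of the 2 k vectors must first be grouped in pairs
    ([independent_pair_events] and Dynkin's lemma [independent_sigma]).  The
    moments of the normal law come from integration by parts
    ([normal_moment_rec]). *)

Set Implicit Arguments.
Unset Strict Implicit.
Unset Printing Implicit Defensive.

Import Order.TTheory GRing.Theory Num.Theory.
Import numFieldNormedType.Exports.

Local Open Scope classical_set_scope.
Local Open Scope ring_scope.

(** * Integrals determined by their values on events *)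

Import HBNNSimple.

Section ImageIntegral.
Context {d} {T : measurableType d} {R : realType}.
Variable mu : {measure set T -> \bar R}.
Variables (f h : T -> R) (phi : R -> R).
Hypotheses (mf : measurable_fun setT f) (mh : measurable_fun setT h).
Hypothesis h0 : forall x, 0 <= h x.
Hypotheses (mphi : measurable_fun setT phi) (phi0 : forall r, 0 <= phi r).

Let mphiE : measurable_fun setT (fun r => (phi r)%:E).
Proof. exact/measurable_EFinP. Qed.

Let psi n : {nnsfun R >-> R} := nnsfun_approx measurableT mphiE n.
Let s n := fset_set (range (psi n)).

(** Monotone approximation by simple functions: the right-hand side depends on
    f and h only through the integrals of h over the events of f. *)
Lemma integral_comp_approx :
  (\int[mu]_x (phi (f x) * h x)%:E =
   limn (fun n => (\sum_(i < #|` s n|) ((s n)`_i)%:E *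
     \int[mu]_(x in f @^-1` (psi n @^-1` [set (s n)`_i])) (h x)%:E)%E))%E.
Proof.
have psi_cvg r : EFin \o psi ^~ r @ \oo --> (phi r)%:E.
  by apply: cvg_nnsfun_approx => // x _; rewrite lee_fin.
have mpsi n : measurable_fun setT (psi n \o f).
  by apply: measurableT_comp.
have mA n i : measurable (f @^-1` (psi n @^-1` [set (s n)`_i])).
  rewrite -[X in measurable X]setTI; apply: mf => //.
transitivity (\int[mu]_x limn (fun n => (psi n (f x) * h x)%:E))%E.
  apply: eq_integral => x _; apply/esym/cvg_lim => //.
  rewrite EFinM; under eq_fun do rewrite EFinM.
  by apply: cvgeZr => //; exact: psi_cvg.
rewrite monotone_convergence//; last 3 first.
- move=> n; apply/measurable_EFinP; apply: measurable_funM => //.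
  exact: mpsi.
- by move=> n x _; rewrite lee_fin mulr_ge0.
- move=> x _ m n mn; rewrite lee_fin ler_wpM2r//.
  exact/lefP/nd_nnsfun_approx.
congr (limn _); apply/funext => n.
transitivity (\int[mu]_x \sum_(i < #|` s n|)
    ((s n)`_i)%:E * ((h x)%:E * (\1_(f @^-1` (psi n @^-1` [set (s n)`_i])) x)%:E))%E.
  apply: eq_integral => x _; rewrite fimfunEord mulr_suml -sumEFin.
  apply: eq_bigr => i _; rewrite -!EFinM; congr EFin.
  by rewrite -mulrA [X in _ * X]mulrC.
have s0 i : (i < #|` s n|)%N -> 0 <= (s n)`_i.
  move=> ilt; have : (s n)`_i \in s n by apply: mem_nth.
  rewrite in_fset_set; last exact: fimfunP.
  by move=> /set_mem[r _ <-]; exact: fun_ge0.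
rewrite ge0_integral_sum//; last 2 first.
- move=> i; apply: emeasurable_funM => //; apply: emeasurable_funM.
    exact/measurable_EFinP.
  by apply/measurable_EFinP/measurable_indic.
- move=> i x _; rewrite -!EFinM lee_fin !mulr_ge0//; exact: s0.
apply: eq_bigr => i _; rewrite ge0_integralZl//; last 3 first.
- apply: emeasurable_funM; first exact/measurable_EFinP.
  by apply/measurable_EFinP/measurable_indic.
- by move=> x _; rewrite -EFinM lee_fin mulr_ge0.
- by rewrite lee_fin; exact: s0.
congr (_ * _)%E; rewrite [RHS]integral_mkcond epatch_indic.
by apply: eq_integral.
Qed.

End ImageIntegral.

(** Covers both the density of a law (h constant, f a random variable, k a
    density on the line) and independence (f = g, k constant). *)
Lemma eq_integral_comp {d1} {T1 : measurableType d1}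
    {d2} {T2 : measurableType d2} {R : realType}
    (mu1 : {measure set T1 -> \bar R}) (mu2 : {measure set T2 -> \bar R})
    (f h : T1 -> R) (g k : T2 -> R) :
  measurable_fun setT f -> measurable_fun setT h -> (forall x, 0 <= h x) ->
  measurable_fun setT g -> measurable_fun setT k -> (forall y, 0 <= k y) ->
  (forall A, measurable A -> \int[mu1]_(x in f @^-1` A) (h x)%:E =
                             \int[mu2]_(y in g @^-1` A) (k y)%:E)%E ->
  forall phi : R -> R, measurable_fun setT phi -> (forall r, 0 <= phi r) ->
  (\int[mu1]_x (phi (f x) * h x)%:E = \int[mu2]_y (phi (g y) * k y)%:E)%E.
Proof.
move=> mf mh h0 mg mk k0 fg phi mphi phi0.
rewrite (integral_comp_approx mu1 mf mh h0 mphi phi0).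
rewrite (integral_comp_approx mu2 mg mk k0 mphi phi0).
congr (limn _); apply/funext => n; apply: eq_bigr => i _; rewrite fg//.
Qed.

(** * Moments of the standard normal law *)

Section GaussianMoments.
Context {R : realType}.
Notation mu := (@lebesgue_measure R).

(** The fundamental theorem on [- n, n], where dominated convergence passes to
    the limit. *)
Lemma integral_derivative_eq0 (F f : R -> R) :
  continuous f -> (forall x : R, is_derive x (1 : R) F (f x)) ->
  mu.-integrable setT (fun x => (f x)%:E) ->
  F n.+1%:R @[n --> \oo] --> (0 : R) -> F (- n.+1%:R) @[n --> \oo] --> (0 : R) ->
  (\int[mu]_x (f x)%:E = 0)%E.
Proof.
move=> cf dF intf Fy FNy.
have mf : measurable_fun setT f by exact: continuous_measurable_fun.
have cF : continuous F.
  move=> x; apply: differentiable_continuous; apply/derivable1_diffP.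
  by have [] := dF x.
pose D n := `[- n.+1%:R, n.+1%:R]%classic : set R.
pose f_ n x := (f x * \1_(D n) x)%:E.
have [|||||_ _] := @dominated_convergence _ _ R mu setT measurableT f_
  (fun x => (f x)%:E) (fun x => `|f x|%:E).
- move=> n; apply/measurable_EFinP; apply: measurable_funM => //.
  by apply: measurable_indic; exact: measurable_itv.
- exact/measurable_EFinP.
- apply: aeW => x _; apply: cvg_near_cst; near=> n.
  rewrite /f_ indicE mem_set ?mulr1// /D /= in_itv/=.
  rewrite -ler_norml (le_trans (ltW (truncnS_gt _)))// ler_nat ltnS.
  by near: n; exact: nbhs_infty_ge.
- exact: integrable_abse intf.
- apply: aeW => x n _; rewrite /f_ /= lee_fin normrM ler_piMr//.
  by rewrite ger0_norm// indicE; case: (_ \in _).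
have -> : [sequence (\int[mu]_x f_ n x)%E]_n =
    (fun n => (F n.+1%:R - F (- n.+1%:R))%:E).
  apply/funext => n /=.
  have ab : - n.+1%:R < n.+1%:R :> R by rewrite (@lt_trans _ _ 0)// oppr_lt0.
  rewrite EFinB -(@continuous_FTC2 _ f)//.
  - by rewrite [RHS]integral_mkcond epatch_indic; apply: eq_integral.
  - exact: continuous_subspaceT.
  - split; [by move=> x _; have [] := dF x| |].
    + exact/cvg_at_right_filter/cF.
    + exact/cvg_at_left_filter/cF.
  - by move=> x _; rewrite derive1E; exact: (@derive_val _ _ _ _ _ _ _ (dF x)).
move=> lim1; have lim2 : ((F n.+1%:R - F (- n.+1%:R))%:E @[n --> \oo] --> 0)%E.
  apply: cvg_EFin; first exact: nearW.
  rewrite -[X in _ --> X](subr0 0); exact: cvgB.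
exact: (cvg_unique _ lim1 lim2).
Unshelve. all: by end_near. Qed.

Lemma normal_pdf01E (x : R) :
  normal_pdf 0 1 x = normal_peak 1 * expR (- (x ^+ 2 / 2)).
Proof.
rewrite normal_pdfE ?oner_eq0// /normal_fun subr0 expr1n mulNr.
by rewrite mulr2n.
Qed.

(** Half of the Gaussian exponent absorbs any power, as y ^ n <= n! exp y for
    y = x ^ 2 / 4.  This gives integrability of all moments and the vanishing of
    the boundary terms at once. *)
Lemma pow_gauss_le n (x : R) :
  `|x| ^+ n * expR (- (x ^+ 2 / 2)) <=
  (1 + 4 ^+ n * n`!%:R) * expR (- (x ^+ 2 / 4)).
Proof.
set y := x ^+ 2 / 4; have y0 : 0 <= y by rewrite divr_ge0// sqr_ge0.
have -> : x ^+ 2 / 2 = y + y by rewrite /y; field.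
rewrite opprD expRD mulrA ler_wpM2r ?expR_ge0//.
rewrite expRN ler_pdivrMr ?expR_gt0//.
have ey1 : 1 <= expR y by rewrite (le_trans _ (expR_ge1Dx _))// lerDl.
have yn : y ^+ n <= n`!%:R * expR y.
  case: n => [|n]; first by rewrite expr0 fact0 mul1r.
  have := expR_ge1Dxn n y0; have f0 : 0 < n.+1`!%:R :> R by rewrite ltr0n fact_gt0.
  move=> h; rewrite mulrC -ler_pdivrMr//; apply: le_trans h; by rewrite lerDr.
have -> : `|x| ^+ n = `|x ^+ n| by rewrite normrX.
have : `|x ^+ n| <= 1 + (x ^+ n) ^+ 2.
  rewrite -[X in _ + X]real_normK ?num_real//; nra.
move/le_trans; apply; rewrite mulrDl mul1r lerD//.
rewrite -exprM mulnC exprM -mulrA; have -> : x ^+ 2 = 4 * y by rewrite /y; field.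
by rewrite exprMn ler_wpM2l// exprn_ge0.
Qed.

(** Up to a factor, this is the density of variance 2. *)
Lemma integrable_gauss4 : mu.-integrable setT (fun x => (expR (- (x ^+ 2 / 4)))%:E).
Proof.
have s0 : Num.sqrt 2 != 0 :> R by rewrite gt_eqF// sqrtr_gt0.
have /(integrableZl measurableT (normal_peak (Num.sqrt 2))^-1) :=
  integrable_normal_pdf 0 (Num.sqrt 2 : R).
apply: eq_integrable => // x _.
rewrite -EFinM normal_pdfE// mulKf ?gt_eqF ?normal_peak_gt0//.
rewrite /normal_fun subr0 sqr_sqrtr// mulNr; congr (expR (- (_ / _))%R)%:E.
by rewrite -mulr_natr; ring.
Qed.

Lemma integrable_pow_gauss n :
  mu.-integrable setT (fun x => (x ^+ n * expR (- (x ^+ 2 / 2)))%:E).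
Proof.
apply: le_integrable (integrableZl measurableT (1 + 4 ^+ n * n`!%:R) integrable_gauss4) => //.
  apply/measurable_EFinP; apply: measurable_funM; first exact: measurable_funX.
  apply: measurableT_comp => //; apply: measurableT_comp => //.
  by apply: measurable_funM => //; exact: measurable_funX.
move=> x _ /=; rewrite !lee_fin !normrM normrX !(ger0_norm (expR_ge0 _)).
rewrite (ger0_norm (_ : 0 <= 1 + _)) ?pow_gauss_le//.
Qed.

(** One spare power of u is bounded together with the others, which leaves a
    factor 1 / (m + 1). *)
Lemma pow_gauss_cvg0 n (u : nat -> R) : (forall m, `|u m| = m.+1%:R) ->
  (u m) ^+ n * expR (- (u m ^+ 2 / 2)) @[m --> \oo] --> (0 : R).
Proof.
move=> um; apply: norm_cvg0.
apply: (@squeeze_cvgr _ _ _ _ (cst 0) (fun m => (1 + 4 ^+ n.+1 * n.+1`!%:R) * m.+1%:R^-1)).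
- apply: nearW => m /=; rewrite normr_ge0/= ler_pdivlMr ?ltr0n//.
  rewrite normrM normrX (ger0_norm (expR_ge0 _)) um -{2}(um m) mulrAC -um -exprSr.
  rewrite (le_trans (pow_gauss_le _ _))// ler_piMr//.
  by rewrite expR_le1 oppr_le0 divr_ge0// sqr_ge0.
- exact: cvg_cst.
- rewrite -[X in _ --> X](mulr0 (1 + 4 ^+ n.+1 * n.+1`!%:R)).
  by apply: cvgM; [exact: cvg_cst|exact: cvg_harmonic].
Qed.

Lemma is_derive_pow_gauss n (x : R) :
  is_derive x (1 : R) (fun x : R => x ^+ n * expR (- (x ^+ 2 / 2)))
    (n%:R * (x ^+ n.-1 * expR (- (x ^+ 2 / 2))) - x ^+ n.+1 * expR (- (x ^+ 2 / 2))).
Proof.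
pose q : {poly R} := - 2^-1 *: 'X^2.
have -> : (fun x : R => x ^+ n * expR (- (x ^+ 2 / 2))) =
    (fun y => ('X^n).[y]) * (expR \o (fun y => q.[y])).
  by apply/funext => y; rewrite !fctE /= hornerZ !hornerXn mulNr [2^-1 * _]mulrC.
apply: is_derive_eq.
rewrite /= /q derivZ !derivXn /GRing.scale /= !(hornerZ, hornerXn, hornerMn).
have -> : - 2^-1 * (x ^+ 2) = - (x ^+ 2 / 2) by ring.
set e := expR _; rewrite !exprS -mulr_natl -(mulr_natl _ 2) expr0 -mulr_natl.
by field.
Qed.

(** Integration by parts against the density: the boundary terms vanish, so
    the moments obey the recursion M(n+1) = n M(n-1). *)
Lemma normal_moment_rec n :
  (\int[mu]_x (x ^+ n.+1 * normal_pdf 0 1 x)%:E =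
   n%:R%:E * \int[mu]_x (x ^+ n.-1 * normal_pdf 0 1 x)%:E)%E.
Proof.
have pdfE m : (\int[mu]_x (x ^+ m * normal_pdf 0 1 x)%:E =
    (normal_peak 1)%:E * \int[mu]_x (x ^+ m * expR (- (x ^+ 2 / 2)))%:E)%E.
  rewrite -integralZl//; last exact: integrable_pow_gauss.
  by apply: eq_integral => x _; rewrite normal_pdf01E mulrCA EFinM.
rewrite !pdfE muleCA; congr (_ * _)%E.
pose g m (x : R) := x ^+ m * expR (- (x ^+ 2 / 2)).
have := @integral_derivative_eq0 (g n) (fun x => n%:R * g n.-1 x - g n.+1 x).
have ing := integrable_pow_gauss.
have inZ := integrableZl measurableT n%:R (ing n.-1).
have cg m : continuous (g m).
  move=> x; apply: differentiable_continuous; apply/derivable1_diffP.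
  by have [] := is_derive_pow_gauss m x.
under eq_integral do rewrite EFinB EFinM.
rewrite integralB//; last exact: ing.
rewrite integralZl//; last exact: ing.
have fin m : (\int[mu]_x (g m x)%:E)%E \is a fin_num.
  by apply: integrable_fin_num => //; exact: ing.
move=> h; have {h} : (n%:R%:E * \int[mu]_x (g n.-1 x)%:E -
    \int[mu]_x (g n.+1 x)%:E = 0)%E.
  apply: h.
  - move=> x; apply: cvgB; last exact: cg.
    by apply: cvgM; [exact: cvg_cst|exact: cg].
  - exact: is_derive_pow_gauss.
  - under eq_fun do rewrite EFinB EFinM.
    by apply: integrableB => //; exact: ing.
  - by apply: (@pow_gauss_cvg0 n (fun m => m.+1%:R)) => m; rewrite ger0_norm.
  - by apply: (@pow_gauss_cvg0 n (fun m => - m.+1%:R)) => m; rewrite normrN ger0_norm.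
move/eqP; rewrite sube_eq ?add0e; last 2 first.
- by rewrite fin_numM.
- by rewrite fin_num_adde_defr// fin.
by move=> /eqP <-.
Qed.

Lemma integrable_normal_moment n :
  mu.-integrable setT (fun x => (x ^+ n * normal_pdf 0 1 x)%:E).
Proof.
apply: eq_integrable (integrableZl measurableT (normal_peak 1) (integrable_pow_gauss n)) => //.
by move=> x _; rewrite -EFinM normal_pdf01E mulrCA.
Qed.

End GaussianMoments.

(** * Means of products of independent variables *)

Section HasMean.
Context {d} {T : measurableType d} {R : realType}.
Variable P : {measure set T -> \bar R}.

Implicit Types (f g : T -> R) (m n c : R).

(** Bundling integrability with the value of the integral keeps all later
    computations in the field of reals. *)
Definition has_mean (f : T -> R) (m : R) : Prop :=
  P.-integrable setT (fun x => (f x)%:E) /\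
  (\int[P]_x (f x)%:E = m%:E)%E.

Lemma has_mean_measurable f m : has_mean f m -> measurable_fun setT f.
Proof. by case=> /measurable_int/measurable_EFinP. Qed.

Lemma eq_has_mean f g m : f =1 g -> has_mean f m -> has_mean g m.
Proof. by move=> /funext ->. Qed.

Lemma has_mean_fine f : P.-integrable setT (fun x => (f x)%:E) ->
  has_mean f (fine (\int[P]_x (f x)%:E)%E).
Proof. by move=> fi; split=> //; rewrite fineK//; exact: integrable_fin_num. Qed.

Lemma has_mean_unique f m1 m2 : has_mean f m1 -> has_mean f m2 -> m1 = m2.
Proof. by move=> [_ e1] [_]; rewrite e1 => -[]. Qed.

Lemma ge0_has_mean f m : measurable_fun setT f -> (forall x, 0 <= f x) ->
  (\int[P]_x (f x)%:E = m%:E)%E -> has_mean f m.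
Proof.
move=> mf f0 e; split=> //; apply/integrableP; split; first exact/measurable_EFinP.
under eq_integral do rewrite gee0_abs ?lee_fin ?f0//.
by rewrite e ltry.
Qed.

Lemma has_meanZ c f m : has_mean f m -> has_mean (fun x => c * f x) (c * m).
Proof.
move=> [fi fm]; split.
  by under eq_fun do rewrite EFinM; exact: integrableZl.
by under eq_integral do rewrite EFinM; rewrite integralZl// fm.
Qed.

Lemma has_meanD f g m n : has_mean f m -> has_mean g n ->
  has_mean (fun x => f x + g x) (m + n).
Proof.
move=> [fi fm] [gi gm]; split.
  by under eq_fun do rewrite EFinD; exact: integrableD.
by under eq_integral do rewrite EFinD; rewrite integralD// fm gm.
Qed.

Lemma has_mean_sum (I : Type) (s : seq I) (f : I -> T -> R) (m : I -> R) :
  (forall i, has_mean (f i) (m i)) ->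
  has_mean (fun x => \sum_(i <- s) f i x) (\sum_(i <- s) m i).
Proof.
move=> h; elim: s => [|i s IH].
  rewrite big_nil; under eq_fun do rewrite big_nil.
  by split; [exact: integrable0|rewrite integral0].
by rewrite big_cons; under eq_fun do rewrite big_cons; exact: has_meanD.
Qed.

Lemma le_has_mean f g m n : has_mean f m -> has_mean g n ->
  (forall x, f x <= g x) -> m <= n.
Proof.
move=> [fi fm] [gi gm] fg; rewrite -lee_fin -fm -gm.
by apply: le_integral => // x _; rewrite lee_fin.
Qed.

End HasMean.

(** A change of variables that allows a density on both sides. *)
Lemma has_mean_comp {d1} {T1 : measurableType d1}
    {d2} {T2 : measurableType d2} {R : realType}
    (mu1 : {measure set T1 -> \bar R}) (mu2 : {measure set T2 -> \bar R})
    (f h : T1 -> R) (g k : T2 -> R) (phi : R -> R) (m : R) :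
  measurable_fun setT f -> measurable_fun setT h -> (forall x, 0 <= h x) ->
  measurable_fun setT g -> measurable_fun setT k -> (forall y, 0 <= k y) ->
  (forall A, measurable A -> \int[mu1]_(x in f @^-1` A) (h x)%:E =
                             \int[mu2]_(y in g @^-1` A) (k y)%:E)%E ->
  measurable_fun setT phi ->
  has_mean mu2 (fun y => phi (g y) * k y) m ->
  has_mean mu1 (fun x => phi (f x) * h x) m.
Proof.
move=> mf mh h0 mg mk k0 fg mphi phim.
have ge0 (psi : R -> R) : measurable_fun setT psi ->
    (forall r, 0 <= psi r <= `|phi r|) ->
    exists c, has_mean mu1 (fun x => psi (f x) * h x) c /\
              has_mean mu2 (fun y => psi (g y) * k y) c.
  move=> mpsi psi0.
  have psig : mu2.-integrable setT (fun y => (psi (g y) * k y)%:E).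
    apply: le_integrable phim.1 => //.
      by apply/measurable_EFinP; apply: measurable_funM => //; exact: measurableT_comp.
    move=> y _ /=; rewrite lee_fin !normrM ler_wpM2r//.
    by have /andP[p0 p1] := psi0 (g y); rewrite ger0_norm.
  have hm := has_mean_fine psig; exists (fine (\int[mu2]_y (psi (g y) * k y)%:E)%E).
  split=> //; apply: ge0_has_mean.
  - by apply: measurable_funM => //; exact: measurableT_comp.
  - by move=> x; rewrite mulr_ge0//; have /andP[] := psi0 (f x).
  - rewrite (eq_integral_comp mf mh h0 mg mk k0 fg mpsi); first by case: hm.
    by move=> r; have /andP[] := psi0 r.
have [|r|c [c1 c2]] := ge0 (fun r => Num.max (phi r) 0).
- exact: measurable_maxr.
- by rewrite le_max lexx orbT ge_max ler_norm normr_ge0.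
have [|r|c' [c'1 c'2]] := ge0 (fun r => Num.max (- phi r) 0).
- by apply: measurable_maxr => //; exact: measurableT_comp.
- by rewrite le_max lexx orbT ge_max -normrN ler_norm normr_ge0.
have phiE r : phi r = Num.max (phi r) 0 + -1 * Num.max (- phi r) 0.
  by rewrite /Num.max oppr_lt0; case: (ltP 0 (phi r)) => ?;
     case: (ltP (phi r) 0) => ?; lra.
have -> : m = c + -1 * c'.
  apply: has_mean_unique phim _.
  by apply: eq_has_mean (has_meanD c2 (has_meanZ (-1) c'2)) => y; rewrite mulrA -mulrDl -phiE.
by apply: eq_has_mean (has_meanD c1 (has_meanZ (-1) c'1)) => x; rewrite mulrA -mulrDl -phiE.
Qed.

Section HasMeanProbability.
Context {d} {T : measurableType d} {R : realType}.
Variable P : probability T R.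

Lemma has_mean_cst (c : R) : has_mean P (fun=> c) c.
Proof.
split; first exact: finite_measure_integrable_cst.
by rewrite integral_cst//= probability_setT mule1.
Qed.

Lemma has_mean_indic (A : set T) : measurable A -> has_mean P (\1_A) (fine (P A)).
Proof.
move=> mA; apply: ge0_has_mean; first exact: measurable_indic.
  by [].
by rewrite integral_indic// setIT fineK// fin_num_measure.
Qed.

End HasMeanProbability.

Section Independence.
Context {d} {T : measurableType d} {R : realType}.
Variable P : probability T R.

Lemma independent_inj (I J : finType) (g : J -> I) (F : I -> set (set T)) :
  injective g -> independent P F -> independent P (F \o g).
Proof.
move=> ginj iF K E FE.
have [-> |[j0 j0K]] := set_0Vmem K.
  rewrite big_set0 (_ : \bigcap_(i in _) _ = setT) ?probability_setT//.
  by apply/seteqP; split=> // x _ i /=; rewrite inE.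
pose E' i := E (odflt j0 [pick j | g j == i]).
have E'g j : E' (g j) = E j.
  rewrite /E'; case: pickP => [j' /eqP/ginj ->//|/(_ j)].
  by rewrite eqxx.
have := iF [set g j | j in K]%SET E' _.
rewrite big_imset /=; last by move=> x y _ _; exact: ginj.
under eq_bigr do rewrite E'g.
move=> <-; last by move=> _ /imsetP[j jK ->]; rewrite E'g; exact: FE.
congr (P _); apply/seteqP; split=> x Hx i /=.
  by move=> /imsetP[j jK ->]; rewrite E'g; exact: Hx.
by move=> iK; rewrite -E'g; apply: Hx; apply/imsetP; exists i.
Qed.

(** Independence states the factorisation for indicators of events.  Indicators
    are replaced by the variables one index at a time: when all other factors are
    kept fixed, the statement for the indicators of all events of f_j says that
    the product of the other factors and a constant integrate alike over these
    events, so that [eq_integral_comp] applies. *)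
Lemma independent_has_mean_ge0 (I : finType) (F : I -> set (set T))
    (f : I -> T -> R) (m : I -> R) :
  independent P F ->
  (forall i A, measurable A -> F i (f i @^-1` A)) ->
  (forall i x, 0 <= f i x) -> (forall i, has_mean P (f i) (m i)) ->
  has_mean P (fun x => \prod_i f i x) (\prod_i m i).
Proof.
move=> iF Ff f0 fm.
have mf i := has_mean_measurable (fm i).
have mFf i A : measurable A -> measurable (f i @^-1` A).
  by move=> mA; rewrite -[X in measurable X]setTI; exact: mf.
(* the variables of index in s are kept, the others replaced by indicators *)
suff H (s : seq I) (g : I -> T -> R) (c : I -> R) :
    (forall i, if i \in s then g i = f i /\ c i = m i
       else exists2 A : set R, measurable A &
         g i = \1_(f i @^-1` A) /\ c i = fine (P (f i @^-1` A))) ->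
    has_mean P (fun x => \prod_i g i x) (\prod_i c i).
  by apply: (H (index_enum I)) => i; rewrite mem_index_enum.
elim: s g c => [|j s IH] g c gc.
  have [A hA] : {A : I -> set R & forall i, measurable (A i) /\
      (g i = \1_(f i @^-1` A i) /\ c i = fine (P (f i @^-1` A i)))}.
    apply: (@choice _ _ (fun i A => measurable A /\
      (g i = \1_(f i @^-1` A) /\ c i = fine (P (f i @^-1` A))))) => i.
    by have /= [A mA e] := gc i; exists A.
  pose E i := f i @^-1` A i.
  have mE i : measurable (E i) by apply: mFf; case: (hA i).
  have mC : measurable (\bigcap_(i in [set` [set: I]%SET]) E i).
    by apply: fin_bigcap_measurable => //; exact: finite_finset.
  have := has_mean_indic P mC; rewrite iF; last first.
    by move=> i _; apply: Ff; case: (hA i).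
  congr has_mean.
    apply/funext => x; rewrite indicE.
    have [xE|xE] := pselect (forall i, E i x).
      rewrite mem_set; last by move=> i _; exact: xE.
      rewrite big1// => i _; have [_ [-> _]] := hA i.
      by rewrite indicE mem_set//; exact: xE.
    rewrite memNset; last by move=> h; apply: xE => i; apply: h => /=; rewrite inE.
    have [i nEi] : exists i, ~ E i x by apply/existsNP.
    by rewrite (bigD1 i)//=; have [_ [-> _]] := hA i; rewrite indicE memNset// mul0r.
  rewrite big_mkcond/= -[RHS]/(fine (\prod_i c i)%:E); congr fine.
  rewrite -prodEFin; apply: eq_bigr => i _; rewrite inE.
  have [_ [_ ->]] := hA i; rewrite fineK//; apply: fin_num_measure; exact: mE.
have [js|js] := boolP (j \in s).
  by apply: IH => i; have := gc i; rewrite inE; case: eqP => // ->; rewrite js.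
have /= := gc j; rewrite inE eqxx/= => -[gj cj].
pose h x := \prod_(i | i != j) g i x; pose C := \prod_(i | i != j) c i.
have hg i x : 0 <= g i x.
  by have := gc i; case: ifP => _ [] => [->|A mA [-> _]].
have hA A : measurable A -> has_mean P (fun x => \1_(f j @^-1` A) x * h x)
    (fine (P (f j @^-1` A)) * C).
  move=> mA.
  have := IH (fun i => if i == j then \1_(f j @^-1` A) else g i)
    (fun i => if i == j then fine (P (f j @^-1` A)) else c i).
  rewrite (bigD1 j)//= eqxx.
  under eq_bigr => i ij do rewrite (negbTE ij).
  under [X in has_mean P X _]eq_fun => x.
    rewrite (bigD1 j)//= eqxx.
    under eq_bigr => i ij do rewrite (negbTE ij).
    over.
  apply=> i; have [->|ij] := eqVneq i j.
    by rewrite (negbTE js); exists A.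
  by have := gc i; rewrite inE (negbTE ij).
have h0 x : 0 <= h x by apply: prodr_ge0 => i _; exact: hg.
have hT : has_mean P h C.
  have := hA setT measurableT; rewrite preimage_setT probability_setT mul1r.
  by apply: eq_has_mean => x; rewrite indicT mul1r.
have mh := has_mean_measurable hT.
have C0 : 0 <= C.
  by apply: le_has_mean (has_mean_cst P 0) hT _ => x.
rewrite (bigD1 j)//= -/C cj.
under [X in has_mean P X _]eq_fun => x do rewrite (bigD1 j)//= -/(h x) gj.
apply: ge0_has_mean.
- exact: measurable_funM.
- by move=> x; rewrite mulr_ge0.
have {hA} hA A : measurable A -> (\int[P]_(x in f j @^-1` A) (h x)%:E =
    \int[P]_(x in f j @^-1` A) C%:E)%E.
  move=> mA; rewrite integral_cst//; last exact: mFf.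
  have [_] := hA A mA; rewrite EFinM fineK; last by apply: fin_num_measure; exact: mFf.
  rewrite [RHS]muleC => <-; rewrite [LHS]integral_mkcond epatch_indic.
  by apply: eq_integral => x _; rewrite mulrC EFinM.
(* a nonnegative function on the line that fixes the values of f_j *)
have := eq_integral_comp (mf j) mh h0 (mf j) (measurable_cst _) (fun=> C0) hA
  (@normr_measurable R setT) (@normr_ge0 _ _).
under eq_integral do rewrite ger0_norm//.
move=> ->//.
under eq_integral do rewrite ger0_norm// mulrC.
by have [_ ->] := has_meanZ C (fm j); rewrite mulrC.
Qed.

(** Signed variables are split into positive and negative parts; distributing
    the product over the sums reduces to nonnegative factors, for every choice of
    signs. *)
Lemma independent_has_mean_prod (I : finType) (F : I -> set (set T))
    (f : I -> T -> R) (m : I -> R) :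
  independent P F ->
  (forall i A, measurable A -> F i (f i @^-1` A)) ->
  (forall i, has_mean P (f i) (m i)) ->
  has_mean P (fun x => \prod_i f i x) (\prod_i m i).
Proof.
move=> iF Ff fm.
pose sg (b : bool) : R := (-1) ^+ b.
pose part (b : bool) (r : R) := Num.max (sg b * r) 0.
have mpart b : measurable_fun setT (part b).
  apply: measurable_maxr => //; exact: measurable_funM.
have partE r : r = \sum_(b : bool) sg b * part b r.
  rewrite big_bool /part /sg /= expr1 expr0 !mul1r !mulN1r.
  by rewrite /Num.max oppr_lt0; case: (ltP 0 r) => ?; case: (ltP r 0) => ?; lra.
have mf i := has_mean_measurable (fm i).
have pint b i : P.-integrable setT (fun x => (part b (f i x))%:E).
  apply: le_integrable (fm i).1 => //.
    by apply/measurable_EFinP; exact: measurableT_comp.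
  move=> x _ /=; rewrite lee_fin /part /sg /Num.max.
  by case: ltP => _; rewrite ?normr0// normrM normrX normrN1 expr1n mul1r.
have pm b i := has_mean_fine (pint b i).
pose M b i := fine (\int[P]_x (part b (f i x))%:E)%E.
have mE i : m i = \sum_(b : bool) sg b * M b i.
  apply: has_mean_unique (fm i) _.
  have := has_mean_sum (index_enum bool) (fun b => has_meanZ (sg b) (pm b i)).
  by apply: eq_has_mean => x; rewrite -partE.
under eq_bigr do rewrite mE.
under [X in has_mean P X _]eq_fun => x.
  under eq_bigr => i _ do rewrite [f i x]partE.
  rewrite bigA_distr_bigA; over.
rewrite bigA_distr_bigA /=; apply: has_mean_sum => s.
rewrite big_split /=.
under [X in has_mean P X _]eq_fun do rewrite big_split /=.
apply: has_meanZ; apply: independent_has_mean_ge0 iF _ _ _.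
- move=> i A mA; rewrite (_ : _ @^-1` A = f i @^-1` (part (s i) @^-1` A))//.
  by apply: Ff; rewrite -[X in measurable X]setTI; exact: mpart.
- by move=> i x; rewrite le_max lexx orbT.
- by move=> i; exact: pm.
Qed.

(** Dynkin's lemma, applied to one index after the other. *)
Lemma independent_sigma (I : finType) (F : I -> set (set T)) :
  (forall i A, F i A -> measurable A) -> (forall i, setI_closed (F i)) ->
  independent P F -> independent P (fun i => <<s F i >>).
Proof.
move=> mF FI iF.
have smF i A : <<s F i >> A -> measurable A.
  apply: smallest_sub; last exact: mF.
  exact: sigma_algebra_measurable.
suff H (s : seq I) (J : {set I}) (E : I -> set T) :
    (forall i, i \in J -> if i \in s then <<s F i >> (E i) else F i (E i)) ->
    P (\bigcap_(i in [set` J]) E i) = (\prod_(i in J) P (E i))%E.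
  move=> J E FE; apply: (H (index_enum I)) => i iJ.
  by rewrite mem_index_enum; exact: FE.
elim: s J E => [|j s IH] J E FE; first by apply: iF => i /FE.
have [js|js] := boolP (j \in s).
  by apply: IH => i /FE; rewrite inE; case: eqP => // ->; rewrite js.
have [jJ|jJ] := boolP (j \in J); last first.
  apply: IH => i iJ; have := FE _ iJ; rewrite inE; case: eqP => //= ij.
  by move: jJ; rewrite -ij iJ.
pose H := \bigcap_(i in [set` J :\ j]) E i.
pose c := (\prod_(i in J :\ j) P (E i))%E.
have mE i : i \in J -> measurable (E i).
  move=> iJ; have := FE _ iJ; case: ifP => _; [exact: smF|exact: mF].
have mH : measurable H.
  apply: fin_bigcap_measurable; first exact: finite_finset.
  by move=> i /=; rewrite !inE => /andP[_]; exact: mE.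
have PH : P H = c.
  apply: IH => i; rewrite !inE => /andP[ij iJ]; have := FE _ iJ.
  by rewrite inE (negbTE ij).
have JE E' : (forall i, i != j -> E' i = E i) ->
    P (\bigcap_(i in [set` J]) E' i) = P (E' j `&` H) /\
    (\prod_(i in J) P (E' i))%E = (P (E' j) * c)%E.
  move=> E'E; split.
    congr (P _); apply/seteqP; split=> x Hx.
      split; first exact: Hx.
      move=> i /=; rewrite !inE => /andP[ij iJ]; rewrite -E'E//; exact: Hx.
    move=> i /= iJ; have [->|ij] := eqVneq i j; first by case: Hx.
    by rewrite E'E//; case: Hx => _; apply; rewrite /= !inE ij.
  rewrite (big_setD1 j)//=; congr (_ * _)%E; apply: eq_bigr => i.
  by rewrite !inE => /andP[ij _]; rewrite E'E.
have [-> ->] := JE E (fun _ _ => erefl).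
have cfin : c \is a fin_num by rewrite -PH fin_num_measure.
pose D := [set A : set T | measurable A /\ P (A `&` H) = (P A * c)%E].
have FD : F j `<=` D.
  move=> A FA; split; first exact: mF FA.
  pose E' i := if i == j then A else E i.
  have [|] := JE E'; first by move=> i ij; rewrite /E' (negbTE ij).
  rewrite /E' eqxx => <- <-; apply: IH => i iJ.
  have [->|ij] := eqVneq i j; first by rewrite (negbTE js).
  by have := FE _ iJ; rewrite inE (negbTE ij).
have dD : dynkin D.
  split.
  - by split=> //; rewrite setTI PH probability_setT mul1e.
  - move=> A [mA PA]; split; first exact: measurableC.
    have : P H = (P (A `&` H) + P (~` A `&` H))%E.
      rewrite -measureU//; [|exact: measurableI| |].
      + by rewrite -setIUl setUv setTI.
      + by apply: measurableI => //; exact: measurableC.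
      + by rewrite setIACA setICr set0I.
    rewrite PA probability_setC// PH => e.
    rewrite muleBl// mul1e [X in (X - _)%E]e addeAC subee ?add0e//.
    by rewrite fin_numM// fin_num_measure.
  - move=> A tA DA; split; first by apply: bigcup_measurable => k _; case: (DA k).
    have mA k : measurable (A k) by case: (DA k).
    rewrite setI_bigcupl !measure_bigcup//; last 2 first.
    + by move=> k _; exact: measurableI.
    + exact: trivIset_setIr.
    rewrite muleC -(fineK cfin) -nneseriesZl//; apply: eq_eseriesr => k _.
    by rewrite fineK// muleC; have [_] := DA k.
have : <<s F j >> (E j) by have := FE _ jJ; rewrite inE eqxx.
rewrite -setI_closed_g_dynkin_g_sigma_algebra// => dE.
by have [] : D (E j) by apply: dE.
Qed.

End Independence.

(** * Quadratic forms and fourth moments *)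

Section QuadraticForms.
Context {R : realType}.

Definition qform {n} (A : 'I_n -> 'I_n -> R) (u : 'I_n -> R) : R :=
  \sum_i \sum_j A i j * (u i * u j).

(** Matrices are functions here, so that a matrix whose entries are themselves
    quadratic forms in a second vector needs no conversion. *)
Definition psd_form {n} (A : 'I_n -> 'I_n -> R) : Prop :=
  (forall i j, A i j = A j i) /\ forall u, 0 <= qform A u.

Lemma sum_deltal {n} (i : 'I_n) (F : 'I_n -> R) :
  \sum_k (i == k)%:R * F k = F i.
Proof.
rewrite (bigD1 i)//= eqxx mul1r big1 ?addr0// => k ki.
by rewrite eq_sym (negbTE ki) mul0r.
Qed.

Lemma qform_delta2 {n} (A : 'I_n -> 'I_n -> R) s t (i j : 'I_n) :
  (forall i j, A i j = A j i) ->
  qform A (fun k => (i == k)%:R * s + (j == k)%:R * t) =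
  s ^+ 2 * A i i + 2 * s * t * A i j + t ^+ 2 * A j j.
Proof.
move=> Asym.
have e (F : 'I_n -> R) : \sum_k F k * ((i == k)%:R * s + (j == k)%:R * t) =
    s * F i + t * F j.
  rewrite -[s * F i](sum_deltal i (fun k => s * F k)).
  rewrite -[t * F j](sum_deltal j (fun k => t * F k)) -big_split /=.
  by apply: eq_bigr => k _; ring.
rewrite /qform; under eq_bigr => k _.
  under eq_bigr do rewrite mulrCA.
  rewrite -mulr_sumr e mulrC; over.
by rewrite /= e (Asym j i); ring.
Qed.

Lemma psd_form_diag_ge0 {n} (A : 'I_n -> 'I_n -> R) (i : 'I_n) :
  psd_form A -> 0 <= A i i.
Proof.
move=> [Asym A0]; have := qform_delta2 1 0 i i Asym.
by rewrite expr1n expr0n /= !(mulr0, mul0r, mul1r, addr0) => <-.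
Qed.

(** The form is nonnegative on the plane of two basis vectors, so its
    discriminant is not positive. *)
Lemma psd_form_entry_le {n} (A : 'I_n -> 'I_n -> R) (i j : 'I_n) :
  psd_form A -> A i j ^+ 2 <= A i i * A j j.
Proof.
move=> psdA; have [Asym A0] := psdA.
have h s t : 0 <= s ^+ 2 * A i i + 2 * s * t * A i j + t ^+ 2 * A j j.
  by rewrite -qform_delta2.
have Aii := psd_form_diag_ge0 i psdA.
have := psd_form_diag_ge0 j psdA; rewrite le_eqVlt => /predU1P[Ajj|Ajj].
  (* a null diagonal entry: the form is affine in t, hence constant *)
  have := h (A i j) (- (A i i + 1)); rewrite -Ajj; nra.
have hs := h (A j j) (- A i j).
rewrite -(@ler_pM2l _ (A j j))//; nra.
Qed.

(** The mean of x_i x_j x_k x_l for independent centred reduced variables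
    whose fourth moment is [kappa]: Wick's three pairings, and a correction on
    the diagonal. *)
Definition wick4 {n} (kappa : R) (i j k l : 'I_n) : R :=
  (i == j)%:R * (k == l)%:R + (i == k)%:R * (j == l)%:R +
  (i == l)%:R * (j == k)%:R +
  (kappa - 3) * ((i == j)%:R * (i == k)%:R * (i == l)%:R).

(** The diagonal pairing contributes tr(A) ^ 2; each of the two crossed ones
    contributes the sum of the A_ij ^ 2, at most tr(A) ^ 2 by
    [psd_form_entry_le]; the diagonal correction is not positive. *)
Lemma sum_wick4_le {n} (kappa : R) (A : 'I_n -> 'I_n -> R) :
  kappa <= 3 -> psd_form A ->
  \sum_i \sum_j \sum_k \sum_l A i j * A k l * wick4 kappa i j k l <=
  3 * (\sum_i A i i) ^+ 2.
Proof.
move=> k3 psdA; have [Asym _] := psdA.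
have inner i j : \sum_k \sum_l A i j * A k l * wick4 kappa i j k l =
    A i j * ((i == j)%:R * (\sum_k A k k) + A i j + A j i +
             (kappa - 3) * ((i == j)%:R * A i i)).
  transitivity (A i j * \sum_k ((i == j)%:R * A k k + (i == k)%:R * A k j +
      (j == k)%:R * A k i + (i == k)%:R * ((kappa - 3) * (i == j)%:R * A k i))).
    rewrite mulr_sumr; apply: eq_bigr => k _.
    transitivity (A i j * \sum_l ((k == l)%:R * ((i == j)%:R * A k l) +
        (j == l)%:R * ((i == k)%:R * A k l) + (i == l)%:R * ((j == k)%:R * A k l) +
        (i == l)%:R * ((i == k)%:R * ((kappa - 3) * (i == j)%:R * A k l)))).
      by rewrite mulr_sumr; apply: eq_bigr => l _; rewrite /wick4; ring.
    by rewrite !big_split /= !sum_deltal.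
  by rewrite !big_split /= !sum_deltal -mulr_sumr; ring.
under eq_bigr do under eq_bigr do rewrite inner.
have Aii i := psd_form_diag_ge0 i psdA.
have step i : \sum_j A i j * ((i == j)%:R * (\sum_k A k k) + A i j + A j i +
      (kappa - 3) * ((i == j)%:R * A i i)) <= 3 * (A i i * \sum_k A k k).
  have -> : 3 * (A i i * \sum_k A k k) = A i i * (\sum_k A k k) +
      \sum_k 2 * (A i i * A k k) by rewrite -!mulr_sumr; ring.
  rewrite -[X in _ <= X + _](sum_deltal i (fun j => A i j * \sum_k A k k)).
  rewrite -big_split /=; apply: ler_sum => j _.
  have Aij := psd_form_entry_le i j psdA; rewrite (Asym j i).
  have : 0 <= (3 - kappa) * (i == j)%:R * (A i j * A i i).
    by have [<-|_] := eqVneq i j; rewrite ?mulr0 ?mul0r// !mulr_ge0//; lra.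
  by set D := \sum_k _; nra.
apply: (le_trans (ler_sum _ (fun i _ => step i))).
by rewrite -mulr_sumr -mulr_suml expr2.
Qed.

Lemma qform_sqr {n} (A : 'I_n -> 'I_n -> R) (u : 'I_n -> R) :
  qform A u ^+ 2 = \sum_i \sum_j \sum_k \sum_l
    A i j * A k l * (u i * u j * u k * u l).
Proof.
rewrite expr2 {1}/qform mulr_suml; apply: eq_bigr => i _.
rewrite mulr_suml; apply: eq_bigr => j _.
rewrite mulr_sumr; apply: eq_bigr => k _.
rewrite mulr_sumr; apply: eq_bigr => l _; ring.
Qed.

(** Moments of order at most 4 of a centred reduced variable with vanishing
    third moment; the value at higher orders has no meaning. *)
Definition moment (kappa : R) (e : nat) : R := nth 0 [:: 1; 0; 1; 0; kappa] e.

Lemma prod_moment_eq0 {n} (kappa : R) (c : 'I_n -> nat) (i : 'I_n) :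
  moment kappa (c i) = 0 -> \prod_p moment kappa (c p) = 0.
Proof. by move=> ci; rewrite (bigD1 i)//= ci mul0r. Qed.

Lemma prod_moment2 {n} (kappa : R) (i j : 'I_n) :
  \prod_p moment kappa ((p == i) + (p == j)) = (i == j)%:R.
Proof.
have [<-|ij] := eqVneq i j.
  rewrite (bigD1 i)//= eqxx big1 ?mulr1// => p pi.
  by rewrite (negbTE pi).
by apply: (prod_moment_eq0 (i := i)); rewrite eqxx (negbTE ij).
Qed.

(** A monomial with an entry of multiplicity one or three has mean zero, so the
    indices must pair up. *)
Lemma prod_moment4 {n} (kappa : R) (i j k l : 'I_n) :
  \prod_p moment kappa ((p == i) + (p == j) + (p == k) + (p == l)) =
  wick4 kappa i j k l.
Proof.
have two (a b : 'I_n) (c : 'I_n -> nat) : a != b -> c a = 2%N -> c b = 2%N ->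
    (forall p, p != a -> p != b -> c p = 0%N) -> \prod_p moment kappa (c p) = 1.
  move=> ab ca cb c0; rewrite (bigD1 a)// (bigD1 b)//=; last by rewrite eq_sym.
  rewrite ca cb big1 ?mulr1// => p /andP[pa pb]; by rewrite c0.
rewrite /wick4.
have [<-|ij] := eqVneq i j.
  have [<-|kl] := eqVneq k l.
    have [<-|ik] := eqVneq i k.
      rewrite (bigD1 i)//= eqxx big1 => [|p pi]; first by rewrite /moment/= ?mulr1n; ring.
      by rewrite (negbTE pi).
    rewrite (two i k)//; first by rewrite /= ?mulr1n ?mulr0n; ring.
    - by rewrite eqxx (negbTE ik).
    - by rewrite eqxx (eq_sym k i) (negbTE ik).
    - by move=> p /negbTE -> /negbTE ->.
  have [eik|ik] := eqVneq i k.
    rewrite -{}eik in kl *.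
    rewrite (prod_moment_eq0 (i := l)); first by rewrite (negbTE kl) /= ?mulr1n ?mulr0n; ring.
    by rewrite eqxx (eq_sym l i) (negbTE kl).
  rewrite (prod_moment_eq0 (i := k)); first by rewrite /= ?mulr1n ?mulr0n; ring.
  by rewrite eqxx (eq_sym k i) (negbTE ik) (negbTE kl).
have [<-|ik] := eqVneq i k.
  have [<-|jl] := eqVneq j l.
    rewrite (negbTE ij) (two i j)//; first by rewrite /= ?mulr1n ?mulr0n; ring.
    - by rewrite eqxx (negbTE ij).
    - by rewrite eqxx (eq_sym j i) (negbTE ij).
    - by move=> p /negbTE -> /negbTE ->.
  rewrite (prod_moment_eq0 (i := j)); first by
    rewrite (eq_sym j i) (negbTE ij) /= ?mulr1n ?mulr0n; ring.
  by rewrite eqxx (eq_sym j i) (negbTE ij) (negbTE jl).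
have [<-|il] := eqVneq i l.
  have [<-|jk] := eqVneq j k.
    rewrite (two i j)//; first by rewrite /= ?mulr1n ?mulr0n; ring.
    - by rewrite eqxx (negbTE ij).
    - by rewrite eqxx (eq_sym j i) (negbTE ij).
    - by move=> p /negbTE -> /negbTE ->.
  rewrite (prod_moment_eq0 (i := j)); first by rewrite /= ?mulr1n ?mulr0n; ring.
  by rewrite eqxx (eq_sym j i) (negbTE ij) (negbTE jk).
rewrite (prod_moment_eq0 (i := i)); first by rewrite /= ?mulr1n ?mulr0n; ring.
by rewrite eqxx (negbTE ij) (negbTE ik) (negbTE il).
Qed.

End QuadraticForms.

(** * Moments of the entries of a random vector *)

Section Entries.
Context {d} {T : measurableType d} {R : realType}.
Variable P : probability T R.

Lemma preimage_comp_measurable {d'} {S : measurableType d'} (X : T -> S)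
    (phi : S -> R) (A : set R) :
  measurable_fun setT phi -> measurable A ->
  g_sigma_algebra_preimage X ((phi \o X) @^-1` A).
Proof.
move=> mphi mA; exists (phi @^-1` A); last by rewrite setTI.
by rewrite -[X in measurable X]setTI; exact: mphi.
Qed.

Lemma measurable_entry {n} (X : {RV P >-> n.-tuple R}) (j : 'I_n) :
  measurable_fun setT (entry X j).
Proof.
have mX : measurable_fun setT X by exact: measurable_funPT.
exact: (measurableT_comp (measurable_tnth j) mX).
Qed.

Definition has_moments (kappa : R) (x : T -> R) : Prop :=
  forall e, (e <= 4)%N -> has_mean P (fun w => x w ^+ e) (moment kappa e).

(** The law is only known through its values on Borel sets;
    [has_mean_comp] turns this into integrals against the density. *)
Lemma normal_has_moments (x : T -> R) : measurable_fun setT x ->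
  (forall A, measurable A -> pushforward P x A = normal_prob 0 1 A) ->
  has_moments 3 x.
Proof.
move=> mx xN.
have mom e c : (\int[lebesgue_measure]_r (r ^+ e * normal_pdf 0 1 r)%:E = c%:E)%E ->
    has_mean P (fun w => x w ^+ e) c.
  move=> ec; apply: (@eq_has_mean _ _ _ P (fun w => x w ^+ e * 1)).
    by move=> w; rewrite mulr1.
  apply: (@has_mean_comp _ _ _ _ _ P lebesgue_measure x (fun=> 1) id
    (normal_pdf 0 1) (fun r => r ^+ e)) => //.
  - exact: measurable_normal_pdf.
  - exact: normal_pdf_ge0.
  - move=> A mA; rewrite integral_cst ?mul1e.
      exact: xN.
    by rewrite -[X in measurable X]setTI; exact: mx.
  - by split=> //; exact: integrable_normal_moment.
have m0 : (\int[lebesgue_measure]_r (r ^+ 0 * normal_pdf (0 : R) 1 r)%:E = 1%:E)%E.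
  by under eq_integral do rewrite expr0 mul1r; rewrite integral_normal_pdf.
have m1 : (\int[lebesgue_measure]_r (r ^+ 1 * normal_pdf (0 : R) 1 r)%:E = 0%:E)%E.
  by rewrite (normal_moment_rec 0) mul0e.
have m2 : (\int[lebesgue_measure]_r (r ^+ 2 * normal_pdf (0 : R) 1 r)%:E = 1%:E)%E.
  by rewrite (normal_moment_rec 1) m0 mule1.
have m3 : (\int[lebesgue_measure]_r (r ^+ 3 * normal_pdf (0 : R) 1 r)%:E = 0%:E)%E.
  by rewrite (normal_moment_rec 2) m1 mule0.
have m4 : (\int[lebesgue_measure]_r (r ^+ 4 * normal_pdf (0 : R) 1 r)%:E = 3%:E)%E.
  by rewrite (normal_moment_rec 3) m2 mule1.
by move=> [|[|[|[|[|//]]]]] _; exact: mom.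
Qed.

(** Outside a null set, x ^ e is the indicator of x = 1 plus (- 1) ^ e times that
    of x = - 1; the values on the null set are kept as a term of mean zero. *)
Lemma sign_has_moments (x : T -> R) : measurable_fun setT x ->
  P [set w | x w = 1] = (2^-1)%:E -> P [set w | x w = - 1] = (2^-1)%:E ->
  has_moments 1 x.
Proof.
move=> mx; set A := [set w | _]; set B := [set w | _ = - 1] => PA PB.
have mA : measurable A.
  by rewrite -[X in measurable X]setTI; exact: (mx measurableT _ (measurable_set1 1)).
have mB : measurable B.
  by rewrite -[X in measurable X]setTI; exact: (mx measurableT _ (measurable_set1 (- 1))).
have AB : A `&` B = set0.
  apply/seteqP; split=> // w [e1 e2]; have : (1 : R) = - 1 := etrans (esym e1) e2.
  by lra.
pose N := ~` (A `|` B).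
have mN : measurable N by apply: measurableC; exact: measurableU.
have PN : P N = 0%E.
  have PAB : P (A `|` B) = 1%E.
    rewrite measureU//; transitivity ((2^-1)%:E + (2^-1)%:E : \bar R)%E.
      by congr (_ + _)%E.
    by rewrite -EFinD; congr EFin; field.
  by rewrite probability_setC ?PAB ?subee//; exact: measurableU.
have xN (f : T -> R) : measurable_fun setT f -> has_mean P (fun w => f w * \1_N w) 0.
  move=> mf.
  have mfN : measurable_fun N (fun w => (f w)%:E).
    by apply/measurable_EFinP; exact: measurable_funTS.
  have fE : (fun w => (f w * \1_N w)%:E) = ((fun w => (f w)%:E) \_ N).
    by rewrite epatch_indic; apply/funext => w; rewrite EFinM.
  split; last by rewrite fE -integral_mkcond null_set_integral.
  by rewrite fE -integrable_mkcond//; exact: null_set_integrable.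
move=> e e4.
have := has_meanD (has_meanD (has_mean_indic P mA)
  (has_meanZ ((-1) ^+ e) (has_mean_indic P mB))) (xN _ (measurable_funX e mx)).
rewrite PA PB /= addr0.
have -> : 2^-1 + (-1) ^+ e * 2^-1 = moment 1 e :> R.
  by move: e e4 => [|[|[|[|[|//]]]]] _; rewrite /moment/=; field.
apply: eq_has_mean => w; rewrite !indicE.
have [wA|wA] := pselect (A w).
  rewrite (mem_set wA) (memNset (_ : ~ B w)); last first.
    by move=> wB; have : set0 w by rewrite -AB.
  rewrite (memNset (_ : ~ N w)); last by apply; left.
  by rewrite /= !mulr0 !addr0 wA expr1n.
have [wB|wB] := pselect (B w).
  rewrite (mem_set wB) (memNset wA).
  rewrite (memNset (_ : ~ N w)); last by apply; right.
  by rewrite /= mulr0 addr0 add0r mulr1 wB.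
by rewrite (memNset wA) (memNset wB) (mem_set (_ : N w)) /= ?mulr0 ?add0r ?mulr1// => -[].
Qed.

Lemma prod_entry {n} (u : 'I_n -> R) (i : 'I_n) : \prod_p u p ^+ (p == i) = u i.
Proof.
by rewrite (bigD1 i)//= eqxx expr1 big1 ?mulr1// => p /negbTE ->.
Qed.

Section VectorMoments.
Context {n : nat}.
Variables (kappa : R) (X : {RV P >-> n.-tuple R}).
Hypothesis Xindep : independent_entries X.
Hypothesis Xmom : forall j, has_moments kappa (entry X j).

Lemma monomial_has_mean (c : 'I_n -> nat) : (forall p, c p <= 4)%N ->
  has_mean P (fun w => \prod_p entry X p w ^+ c p) (\prod_p moment kappa (c p)).
Proof.
move=> c4; apply: (independent_has_mean_prod Xindep) => [i A mA|i].
  exact: (@preimage_comp_measurable _ _ (entry X i) (fun r => r ^+ c i)).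
exact: Xmom.
Qed.

Lemma entry2_has_mean i j :
  has_mean P (fun w => entry X i w * entry X j w) (i == j)%:R.
Proof.
rewrite -(prod_moment2 kappa).
apply: eq_has_mean (monomial_has_mean (c := fun p => (p == i) + (p == j))%N _).
  by move=> w; under eq_bigr do rewrite exprD; rewrite big_split /= !prod_entry.
by move=> p; do 2 case: (_ == _).
Qed.

Lemma entry4_has_mean i j k l :
  has_mean P (fun w => entry X i w * entry X j w * entry X k w * entry X l w)
    (wick4 kappa i j k l).
Proof.
rewrite -prod_moment4.
apply: eq_has_mean (monomial_has_mean
  (c := fun p => (p == i) + (p == j) + (p == k) + (p == l))%N _).
  by move=> w; under eq_bigr do rewrite !exprD; rewrite !big_split /= !prod_entry.
by move=> p; do 4 case: (_ == _).
Qed.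

(** Meant for the partial trace, in the randomness of the second factor. *)
Lemma qform_sqr_has_mean (A : 'I_n -> 'I_n -> R) : kappa <= 3 -> psd_form A ->
  exists2 s, has_mean P (fun w => qform A (entry X ^~ w) ^+ 2) s &
             s <= 3 * (\sum_i A i i) ^+ 2.
Proof.
move=> k3 psdA.
exists (\sum_i \sum_j \sum_k \sum_l A i j * A k l * wick4 kappa i j k l);
  last exact: sum_wick4_le.
under [X in has_mean P X _]eq_fun do rewrite qform_sqr.
do 4 (apply: has_mean_sum => ?); apply: has_meanZ; exact: entry4_has_mean.
Qed.

End VectorMoments.
End Entries.

(** * Moments of a quadratic form in a Kronecker product *)

Section KroneckerForm.
Context {R : realType} {m n : nat}.
Variable B : 'M[R]_(m * n).

Definition block_entry (i : 'I_m) (a : 'I_n) (j : 'I_m) (c : 'I_n) : R :=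
  B (mxtens_index (i, a)) (mxtens_index (j, c)).

(** For a fixed second factor v, the matrix of the quadratic form in the first
    factor. *)
Definition slice (v : 'I_n -> R) (i j : 'I_m) : R :=
  qform (fun a c => block_entry i a j c) v.

(** The partial trace of B over the first factor. *)
Definition ptrace (a c : 'I_n) : R := \sum_i block_entry i a i c.

Lemma sum_mxtens_index (F : 'I_(m * n) -> R) :
  \sum_p F p = \sum_i \sum_a F (mxtens_index (i, a)).
Proof.
rewrite pair_big (reindex (@mxtens_index m n)) /=; last first.
  by exists (@mxtens_unindex m n) => p _; rewrite (mxtens_indexK, mxtens_unindexK).
by apply: eq_bigr => -[i a] _.
Qed.

Lemma trace_slice v : \sum_i slice v i i = qform ptrace v.
Proof.
rewrite /slice /qform exchange_big; apply: eq_bigr => a _ /=.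
rewrite exchange_big; apply: eq_bigr => c _ /=.
by rewrite /ptrace mulr_suml.
Qed.

Lemma trace_ptrace : \sum_a ptrace a a = \tr B.
Proof. by rewrite /mxtrace sum_mxtens_index exchange_big. Qed.

Lemma kron_formE (s : m.-tuple R) (t : n.-tuple R) :
  ((kron (cvec s) (cvec t))^T *m B *m kron (cvec s) (cvec t)) 0 0 =
  qform (slice (tnth t)) (tnth s).
Proof.
have kE i a z : kron (cvec s) (cvec t) (mxtens_index (i, a)) z = tnth s i * tnth t a.
  by rewrite /kron /cvec !mxE mxtens_indexK.
rewrite mxE sum_mxtens_index.
transitivity (\sum_j \sum_c \sum_i \sum_a
    block_entry i a j c * (tnth t a * tnth t c) * (tnth s i * tnth s j)).
  apply: eq_bigr => j _; apply: eq_bigr => c _.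
  rewrite mxE kE mulr_suml sum_mxtens_index.
  apply: eq_bigr => i _; apply: eq_bigr => a _.
  by rewrite mxE kE /block_entry; ring.
rewrite /qform /slice exchange_big /=.
under eq_bigr do rewrite exchange_big /=.
rewrite exchange_big /=; apply: eq_bigr => i _.
rewrite exchange_big /=.
under [LHS]eq_bigr do rewrite exchange_big /=.
rewrite exchange_big /=.
rewrite exchange_big /=; apply: eq_bigr => j _; rewrite mulr_suml.
by apply: eq_bigr => a _; rewrite mulr_suml.
Qed.

Hypothesis psdB : psd B.

(** The form of the slice at u is the form of B at the product of u and v. *)
Lemma psd_slice v : psd_form (slice v).
Proof.
have [Bsym B0] := psdB; split=> [i j|u].
  rewrite /slice /qform exchange_big; apply: eq_bigr => a _; apply: eq_bigr => c _ /=.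
  by rewrite /block_entry -{1}Bsym mxE [v c * _]mulrC.
have := B0 (kron (cvec [tuple u i | i < m]) (cvec [tuple v a | a < n])).
rewrite kron_formE.
have E k (w : 'I_k -> R) : tnth [tuple w i | i < k] = w.
  by apply/funext => i; rewrite tnth_mktuple.
by rewrite !E.
Qed.

Lemma psd_ptrace : psd_form ptrace.
Proof.
have [Bsym _] := psdB; split=> [a c|v].
  by apply: eq_bigr => i _; rewrite /block_entry -{1}Bsym mxE.
rewrite -trace_slice; apply: sumr_ge0 => i _.
exact: psd_form_diag_ge0 (psd_slice v).
Qed.

Lemma psd_trace_ge0 : 0 <= \tr B.
Proof.
rewrite -trace_ptrace; apply: sumr_ge0 => a _.
exact: psd_form_diag_ge0 psd_ptrace.
Qed.

End KroneckerForm.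

Section KroneckerMoments.
Context {d} {T : measurableType d} {R : realType}.
Variable P : probability T R.
Context {m n : nat}.
Variables (kappa : R) (X : {RV P >-> m.-tuple R}) (Y : {RV P >-> n.-tuple R}).
Hypothesis kappa3 : kappa <= 3.
Hypothesis Xindep : independent_entries X.
Hypothesis Xmom : forall j, has_moments P kappa (entry X j).
Hypothesis Yindep : independent_entries Y.
Hypothesis Ymom : forall j, has_moments P kappa (entry Y j).
Hypothesis XYindep : independent P (fun b : bool =>
  if b then g_sigma_algebra_preimage X else g_sigma_algebra_preimage Y).

Lemma independent_has_meanM (f : m.-tuple R -> R) (g : n.-tuple R -> R) p q :
  measurable_fun setT f -> measurable_fun setT g ->
  has_mean P (f \o X) p -> has_mean P (g \o Y) q ->
  has_mean P (fun w => f (X w) * g (Y w)) (p * q).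
Proof.
move=> mf mg fp gq.
have := @independent_has_mean_prod _ _ _ P bool _
  (fun b => if b then f \o X else g \o Y) (fun b => if b then p else q) XYindep.
rewrite big_bool /=.
under [X in has_mean P X _]eq_fun do rewrite big_bool /=.
by apply=> -[] // A mA; exact: preimage_comp_measurable.
Qed.

Lemma measurable_qform k (A : 'I_k -> 'I_k -> R) :
  measurable_fun setT (fun t : k.-tuple R => qform A (tnth t)).
Proof.
apply: measurable_sum => i; apply: measurable_sum => j.
by apply: measurable_funM => //; apply: measurable_funM; exact: measurable_tnth.
Qed.

Variable B : 'M[R]_(m * n).
Hypothesis psdB : psd B.

Let quad w := qform (slice B (entry Y ^~ w)) (entry X ^~ w).

(** In both factors only equal indices survive, which sums the diagonal of B. *)
Lemma kron_form_has_mean : has_mean P quad (\tr B).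
Proof.
have slice_mean i j : has_mean P (fun w => slice B (entry Y ^~ w) i j)
    (\sum_a block_entry B i a j a).
  have -> : \sum_a block_entry B i a j a =
      \sum_a \sum_c block_entry B i a j c * (a == c)%:R.
    apply: eq_bigr => a _.
    rewrite -(sum_deltal a (fun c => block_entry B i a j c)).
    by apply: eq_bigr => c _; rewrite mulrC.
  do 2 (apply: has_mean_sum => ?); apply: has_meanZ.
  exact: (entry2_has_mean Yindep Ymom).
rewrite -trace_ptrace exchange_big /=.
rewrite -[X in has_mean _ _ X](_ : \sum_i \sum_j (i == j)%:R *
    \sum_a block_entry B i a j a = _); last first.
  by apply: eq_bigr => i _; rewrite sum_deltal.
apply: has_mean_sum => i; apply: has_mean_sum => j.
apply: (@eq_has_mean _ _ _ P (fun w => entry X i w * entry X j w *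
    slice B (entry Y ^~ w) i j)); first by move=> w; rewrite mulrC.
apply: (independent_has_meanM (f := fun t => tnth t i * tnth t j)
  (g := fun t => slice B (tnth t) i j)).
- by apply: measurable_funM; exact: measurable_tnth.
- exact: measurable_qform.
- exact: (entry2_has_mean Xindep Xmom).
- exact: slice_mean.
Qed.

(** Conditioning on Y without conditional expectations: the fourth moments of X
    are numbers that factor out, so the mean s is also the mean over Y of the
    Wick sum of the slice, which is at most 3 tr(slice) ^ 2 for every value of
    Y. *)
Lemma kron_form_sqr_has_mean :
  exists2 s, has_mean P (fun w => quad w ^+ 2) s & s <= 9 * (\tr B) ^+ 2.
Proof.
have M2 i j k l : exists c, has_mean P (fun w =>
    slice B (entry Y ^~ w) i j * slice B (entry Y ^~ w) k l) c.
  exists (\sum_a \sum_c \sum_e \sum_f block_entry B i a j c *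
    block_entry B k e l f * wick4 kappa a c e f).
  under [X in has_mean P X _]eq_fun => w.
    rewrite /slice {1}/qform mulr_suml.
    under eq_bigr => a _.
      rewrite mulr_suml.
      under eq_bigr => c _.
        rewrite /qform mulr_sumr.
        under eq_bigr => e _ do rewrite mulr_sumr.
        over.
      over.
    over.
  do 4 (apply: has_mean_sum => ?).
  apply: eq_has_mean (has_meanZ _ (entry4_has_mean Yindep Ymom _ _ _ _)) => w.
  ring.
pose N i j k l := sval (cid (M2 i j k l)).
have NP i j k l : has_mean P (fun w =>
    slice B (entry Y ^~ w) i j * slice B (entry Y ^~ w) k l) (N i j k l).
  exact: svalP (cid (M2 i j k l)).
pose s := \sum_i \sum_j \sum_k \sum_l wick4 kappa i j k l * N i j k l.
exists s.
  under [X in has_mean P X _]eq_fun do rewrite /quad qform_sqr.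
  apply: has_mean_sum => i; apply: has_mean_sum => j.
  apply: has_mean_sum => k; apply: has_mean_sum => l.
  apply: (@eq_has_mean _ _ _ P (fun w =>
    entry X i w * entry X j w * entry X k w * entry X l w *
    (slice B (entry Y ^~ w) i j * slice B (entry Y ^~ w) k l))).
    by move=> w; rewrite mulrC.
  apply: (independent_has_meanM
    (f := fun t => tnth t i * tnth t j * tnth t k * tnth t l)
    (g := fun t => slice B (tnth t) i j * slice B (tnth t) k l)).
  - by do !(apply: measurable_funM; last exact: measurable_tnth);
      exact: measurable_tnth.
  - by apply: measurable_funM; exact: measurable_qform.
  - exact: (entry4_has_mean Xindep Xmom).
  - exact: NP.
have sY : has_mean P (fun w => \sum_i \sum_j \sum_k \sum_l
    slice B (entry Y ^~ w) i j * slice B (entry Y ^~ w) k l * wick4 kappa i j k l) s.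
  do 4 (apply: has_mean_sum => ?).
  by apply: eq_has_mean (has_meanZ _ (NP _ _ _ _)) => w; rewrite mulrC.
have [s' s'Y s'le] := qform_sqr_has_mean Yindep Ymom kappa3 (psd_ptrace psdB).
rewrite trace_ptrace in s'le.
have : s <= 3 * s'.
  apply: le_has_mean sY (has_meanZ 3 s'Y) _ => w.
  rewrite -trace_slice; apply: sum_wick4_le => //; exact: psd_slice.
by lra.
Qed.

End KroneckerMoments.

(** * Grouping independent families in pairs *)

Section PairEvents.
Context {d} {T : measurableType d} {R : realType}.
Variable P : probability T R.

(** Only the rectangles: they form a pi-system that generates the sigma-algebra
    of the pair. *)
Definition pair_events (F G : set (set T)) : set (set T) :=
  [set A `&` C | A in F & C in G].

(** The 2 |J| events that make up the rectangles are independent, and so are the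
    two events of each rectangle. *)
Lemma independent_pair_events (I : finType) (F : I + I -> set (set T)) :
  (forall s, F s setT) -> independent P F ->
  independent P (fun i => pair_events (F (inl i)) (F (inr i))).
Proof.
move=> FT iF J E EJ.
have [p pP] : {p : I -> set T * set T & forall i,
    [/\ F (inl i) (p i).1, F (inr i) (p i).2 &
        i \in J -> (p i).1 `&` (p i).2 = E i]}.
  apply: (@choice _ _ (fun i (q : set T * set T) => [/\ F (inl i) q.1,
    F (inr i) q.2 & i \in J -> q.1 `&` q.2 = E i])) => i.
  have [iJ|iJ] := boolP (i \in J); last by exists (setT, setT); split.
  by have [A FA [C FC <-]] := EJ i iJ; exists (A, C); split.
pose E' s := match s with inl i => (p i).1 | inr i => (p i).2 end.
have FE' s : F s (E' s) by case: s => i; have [] := pP i.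
have PE i : i \in J -> P (E i) = (P (p i).1 * P (p i).2)%E.
  move=> iJ; have [_ _ /(_ iJ) <-] := pP i.
  have := iF [set inl i; inr i]%SET E' (fun s _ => FE' s).
  rewrite big_setU1 ?inE//= big_set1 /= => <-; congr (P _).
  apply/seteqP; split=> w.
    by move=> [h1 h2] s /=; rewrite !inE => /orP[] /eqP ->.
  by move=> h; split; [apply: (h (inl i))|apply: (h (inr i))]; rewrite /= !inE eqxx ?orbT.
pose J' := [set s | match s with inl i => i \in J | inr i => i \in J end]%SET.
have := iF J' E' (fun s _ => FE' s).
rewrite (eq_bigl (fun s : I + I => match s with inl i => i \in J | inr i => i \in J end));
  last by move=> s; rewrite inE.
rewrite big_sumType /= -big_split /=.
under eq_bigr => i iJ do rewrite -PE//.
move=> <-; congr (P _); apply/seteqP; split=> w h.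
  move=> [i|i]; rewrite /= inE => iJ; have := h i iJ; have [_ _ /(_ iJ) <-] := pP i;
  by case.
move=> i iJ; have [_ _ /(_ iJ) <-] := pP i.
by split; [apply: (h (inl i))|apply: (h (inr i))]; rewrite /= inE.
Qed.

Lemma pair_events_setI (F G : set (set T)) :
  setI_closed F -> setI_closed G -> setI_closed (pair_events F G).
Proof.
move=> FI GI _ _ [A FA [C GC <-]] [A' FA' [C' GC' <-]].
by exists (A `&` A'); [exact: FI|exists (C `&` C'); [exact: GI|rewrite setIACA]].
Qed.

Lemma preimage_setI_closed {d'} {S : measurableType d'} (X : T -> S) :
  setI_closed (g_sigma_algebra_preimage X).
Proof.
move=> _ _ [A mA <-] [C mC <-]; exists (A `&` C); first exact: measurableI.
by rewrite !setTI.
Qed.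

Lemma preimage_setT {d'} {S : measurableType d'} (X : T -> S) :
  g_sigma_algebra_preimage X setT.
Proof. by exists setT => //; rewrite setTI preimage_setT. Qed.

Lemma preimage_measurable {d'} {S : measurableType d'} (X : T -> S) (A : set T) :
  measurable_fun setT X -> g_sigma_algebra_preimage X A -> measurable A.
Proof. by move=> mX [C mC <-]; exact: mX. Qed.

(** The quadratic form is a polynomial in the entries, and these are measurable
    for the sigma-algebra generated by the rectangles with one full side. *)
Lemma qform_pair_events {m n} (B : 'M[R]_(m * n)) (X : {RV P >-> m.-tuple R})
    (Y : {RV P >-> n.-tuple R}) (phi : R -> R) (A : set R) :
  measurable_fun setT phi -> measurable A ->
  <<s pair_events (g_sigma_algebra_preimage X) (g_sigma_algebra_preimage Y) >>
    ((fun w => phi (qform (slice B (entry Y ^~ w)) (entry X ^~ w))) @^-1` A).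
Proof.
move=> mphi mA; set G := pair_events _ _.
have mX j : measurable_fun setT (entry X j : g_sigma_algebraType G -> R).
  move=> _ C mC; apply: sub_sigma_algebra; rewrite setTI.
  exists (entry X j @^-1` C).
    exact: (@preimage_comp_measurable _ _ _ _ _ X (fun t => tnth t j) C
      (measurable_tnth j) mC).
  by exists setT; [exact: preimage_setT|rewrite setIT].
have mY j : measurable_fun setT (entry Y j : g_sigma_algebraType G -> R).
  move=> _ C mC; apply: sub_sigma_algebra; rewrite setTI.
  exists setT; first exact: preimage_setT.
  exists (entry Y j @^-1` C); last by rewrite setTI.
  exact: (@preimage_comp_measurable _ _ _ _ _ Y (fun t => tnth t j) C
      (measurable_tnth j) mC).
have mQ : measurable_fun setT ((fun w =>
    phi (qform (slice B (entry Y ^~ w)) (entry X ^~ w))) : g_sigma_algebraType G -> R).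
  apply: measurableT_comp => //.
  do 2 (apply: measurable_sum => ?); apply: measurable_funM; last exact: measurable_funM.
  by do 2 (apply: measurable_sum => ?); do 2 apply: measurable_funM => //.
by have := mQ measurableT A mA; rewrite setTI.
Qed.

End PairEvents.

(** * The lower tail of a sum of nonnegative variables *)

Section LowerTail.
Context {R : realType}.

(** The difference vanishes at 0 and its derivative - 1 + u + exp (- u) is
    nonnegative. *)
Lemma expRN_le_quadratic (u : R) : 0 <= u -> expR (- u) <= 1 - u + u ^+ 2 / 2.
Proof.
move=> u0.
pose f (x : R) := 1 - x + x ^+ 2 / 2 - expR (- x).
have df (x : R) : is_derive x (1 : R) f (- 1 + x + expR (- x)).
  have -> : f = (fun x => (1 - 'X + 2^-1 *: 'X^2 : {poly R}).[x]) - (expR \o -%R).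
    apply/funext => y; rewrite /f !fctE /= !(hornerD, hornerN, hornerZ, hornerXn, hornerX, hornerC).
    by rewrite [2^-1 * _]mulrC.
  apply: is_derive_eq.
  rewrite /= !(derivD, derivN, derivZ, derivXn, derivX, derivC) /GRing.scale /=.
  rewrite !(hornerD, hornerN, hornerZ, hornerXn, hornerMn, hornerX, hornerC) -mulr_natl.
  by field.
have cf : continuous f.
  by move=> x; apply: differentiable_continuous; apply/derivable1_diffP; have [] := df x.
have [c c0u] := @MVT_segment R f _ 0 u u0 (fun x _ => df x) (continuous_subspaceT cf).
have -> : f 0 = 0 by rewrite /f expr0n /= mul0r oppr0 expR0; ring.
rewrite !subr0 /f => e; rewrite -subr_ge0 e mulr_ge0//.
by have := expR_ge1Dx (- c); lra.
Qed.

Context {d} {T : measurableType d}.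
Variable P : probability T R.

(** Integrating the quadratic bound, then 1 + x <= exp x. *)
Lemma laplace_le (Q : T -> R) (mu s t : R) : (forall w, 0 <= Q w) -> 0 <= t ->
  has_mean P Q mu -> has_mean P (fun w => Q w ^+ 2) s ->
  exists2 M, has_mean P (fun w => expR (- (t * Q w))) M &
             M <= expR (- (t * mu) + t ^+ 2 * s / 2).
Proof.
move=> Q0 t0 Qmu Qs.
have tQ0 w : 0 <= t * Q w by rewrite mulr_ge0.
have mE : measurable_fun setT (fun w => expR (- (t * Q w))).
  apply: measurableT_comp => //; apply: measurableT_comp => //.
  by apply: measurable_funM => //; exact: has_mean_measurable Qmu.
have Ei : P.-integrable setT (fun w => (expR (- (t * Q w)))%:E).
  apply: le_integrable (has_mean_cst P 1).1 => //; first exact/measurable_EFinP.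
  by move=> w _ /=; rewrite lee_fin normr1 ger0_norm ?expR_ge0// expR_le1 oppr_le0.
have EM := has_mean_fine Ei; eexists; first exact: EM.
have := le_has_mean EM (has_meanD (has_meanD (has_mean_cst P 1)
  (has_meanZ (- t) Qmu)) (has_meanZ (t ^+ 2 / 2) Qs)) _.
move/(_ _)/le_trans; apply.
  move=> w; have := expRN_le_quadratic (tQ0 w); rewrite exprMn; lra.
by apply: le_trans (expR_ge1Dx _); lra.
Qed.

(** Maurer's inequality: nonnegative variables whose second moment is
    controlled by the square of the mean have a sub-Gaussian lower tail,
    whatever their upper tail.  Markov's inequality is applied to the product of
    the exp (- t Q_i). *)
Lemma lower_tail (k : nat) (F : 'I_k -> set (set T)) (Q : 'I_k -> T -> R) (mu v eps : R)
    (s : 'I_k -> R) :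
  0 < mu -> 0 < v -> 0 < eps ->
  independent P F -> (forall i w, 0 <= Q i w) ->
  (forall i (phi : R -> R) A, measurable_fun setT phi -> measurable A ->
     F i ((fun w => phi (Q i w)) @^-1` A)) ->
  (forall i, has_mean P (Q i) mu) ->
  (forall i, has_mean P (fun w => Q i w ^+ 2) (s i)) ->
  (forall i, s i <= v * mu ^+ 2) ->
  (P [set w | (\sum_i Q i w < k%:R * ((1 - eps) * mu))%R] <=
     (expR (- (k%:R * eps ^+ 2 / (2 * v))))%:E)%E.
Proof.
move=> mu0 v0 eps0 iF Q0 FQ Qmu Qs sv.
(* the minimiser of - t eps mu + t ^ 2 v mu ^ 2 / 2 *)
pose t := eps / (v * mu).
have t0 : 0 < t by rewrite divr_gt0// mulr_gt0.
have [M MP] : {M : 'I_k -> R & forall i,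
    has_mean P (fun w => expR (- (t * Q i w))) (M i) /\
    M i <= expR (- (eps / v) + eps ^+ 2 / (2 * v))}.
  apply: (@choice _ _ (fun i M => has_mean P (fun w => expR (- (t * Q i w))) M /\
    M <= expR (- (eps / v) + eps ^+ 2 / (2 * v)))) => i.
  have [M EM Mle] := laplace_le (Q0 i) (ltW t0) (Qmu i) (Qs i).
  exists M; split=> //; apply: (le_trans Mle); rewrite ler_expR lerD//.
    by rewrite lerN2 /t invfM -!mulrA mulVf ?mulr1// gt_eqF.
  apply: (@le_trans _ _ (t ^+ 2 * (v * mu ^+ 2) / 2)).
    by rewrite ler_wpM2r// ler_wpM2l// ?exprn_ge0// ltW.
  rewrite le_eqVlt; apply/orP; left; apply/eqP; rewrite /t.
  by field; rewrite !gt_eqF.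
have EM : has_mean P (fun w => \prod_i expR (- (t * Q i w))) (\prod_i M i).
  apply: (independent_has_mean_prod iF) => [i A mA|i]; last by case: (MP i).
  apply: (FQ i (fun r => expR (- (t * r)))) => //.
  by apply: measurableT_comp => //; apply: measurableT_comp.
have Mle : \prod_i M i <= expR (k%:R * (- (eps / v) + eps ^+ 2 / (2 * v))).
  rewrite expRM_natl -[X in _ ^+ X]card_ord -prodr_const.
  apply: ler_prod => i _; have [hm hle] := MP i; rewrite hle andbT.
  by apply: le_has_mean (has_mean_cst P 0) hm _ => w; exact: expR_ge0.
set S := [set w | _].
have mSum : measurable_fun setT (fun w => \sum_i Q i w).
  by apply: measurable_sum => i; exact: has_mean_measurable (Qmu i).
have mS : measurable S.
  have := mSum measurableT _ (measurable_itv `]-oo, (k%:R * ((1 - eps) * mu))[).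
  rewrite setTI; congr measurable; apply/seteqP; split=> w /=; by rewrite in_itv.
(* t times the threshold that defines S *)
pose a := k%:R * ((1 - eps) * eps / v).
have := le_has_mean (has_mean_indic P mS) (has_meanZ (expR a) EM) _.
move/(_ _)/le_trans.
have -> : P S = (fine (P S))%:E by rewrite fineK// fin_num_measure.
rewrite lee_fin; apply.
  move=> w; rewrite -expR_sum -expRD indicE.
  have [wS|wS] := pselect (S w); last by rewrite memNset// expR_ge0.
  rewrite mem_set//= -[leLHS]expR0 ler_expR sumrN -mulr_sumr subr_ge0.
  have -> : a = t * (k%:R * ((1 - eps) * mu)).
    by rewrite /a /t; field; rewrite !gt_eqF.
  by rewrite ler_wpM2l// ltW.
apply: (le_trans (ler_wpM2l (expR_ge0 _) Mle)).
rewrite -expRD ler_expR le_eqVlt; apply/orP; left; apply/eqP; rewrite /a.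
by field; rewrite gt_eqF.
Qed.

End LowerTail.

(** The bound depends on the law only through kappa <= 3, which covers the
    Gaussian and the Rademacher case together.  A null trace is treated apart,
    as [lower_tail] divides by it: then the estimator is at least the trace,
    being nonnegative. *)
Lemma Est_lower_tail {d} {T : measurableType d} {R : realType}
    (P : probability T R) {k m n : nat} (kappa : R) (B : 'M[R]_(m * n))
    (X : 'I_k -> {RV P >-> m.-tuple R}) (Y : 'I_k -> {RV P >-> n.-tuple R})
    (eps : R) :
  (0 < k)%N -> psd B -> jointly_independent X Y -> kappa <= 3 ->
  (forall i, independent_entries (X i) /\
             forall j, has_moments P kappa (entry (X i) j)) ->
  (forall i, independent_entries (Y i) /\
             forall j, has_moments P kappa (entry (Y i) j)) ->
  0 < eps -> eps < 1 ->
  ((1 - expR (- (k%:R * eps ^+ 2 / 18)))%:E <=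
     P [set w | (\tr B <= (1 - eps)^-1 * Est B X Y w)%R])%E.
Proof.
move=> k0 psdB iXY k3 hX hY eps0 eps1.
pose Q i w := qform (slice B (entry (Y i) ^~ w)) (entry (X i) ^~ w).
have Q0 i w : 0 <= Q i w.
  by have [_ s0] := psd_slice psdB (entry (Y i) ^~ w); exact: s0.
have mX i : measurable_fun setT (X i) by exact: measurable_funPT.
have mY i : measurable_fun setT (Y i) by exact: measurable_funPT.
have iF : independent P (fun i => <<s pair_events
    (g_sigma_algebra_preimage (X i)) (g_sigma_algebra_preimage (Y i)) >>).
  apply: independent_sigma => [i A [C hC [D hD <-]]|i|].
  - apply: measurableI; first exact: preimage_measurable (mX i) hC.
    exact: preimage_measurable (mY i) hD.
  - by apply: pair_events_setI; exact: preimage_setI_closed.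
  - apply: independent_pair_events iXY => -[i|i]; exact: preimage_setT.
have iB i : independent P (fun b : bool => if b
    then g_sigma_algebra_preimage (X i) else g_sigma_algebra_preimage (Y i)).
  have gi : injective (fun b : bool => if b then inl i else inr i : 'I_k + 'I_k).
    by move=> [] [].
  have := independent_inj gi iXY; congr independent.
  by apply/funext => -[].
have Qmu i : has_mean P (Q i) (\tr B).
  have [iX mX4] := hX i; have [iY mY4] := hY i.
  exact: (kron_form_has_mean iX mX4 iY mY4 (iB i) B).
have Qs i : exists s, has_mean P (fun w => Q i w ^+ 2) s /\ s <= 9 * \tr B ^+ 2.
  have [iX mX4] := hX i; have [iY mY4] := hY i.
  have [s ? ?] := kron_form_sqr_has_mean k3 iX mX4 iY mY4 (iB i) psdB.
  by exists s.
have [s sP] := choice Qs.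
have EstE w : Est B X Y w = k%:R^-1 * \sum_i Q i w.
  by rewrite /Est; congr (_ * _); apply: eq_bigr => i _; rewrite kron_formE.
have kgt0 : 0 < k%:R :> R by rewrite ltr0n.
have e1 : 0 < 1 - eps by rewrite subr_gt0.
have goodE : [set w | (\tr B <= (1 - eps)^-1 * Est B X Y w)%R] =
    ~` [set w | (\sum_i Q i w < k%:R * ((1 - eps) * \tr B))%R].
  apply/seteqP; split=> w /=; rewrite EstE ler_pdivlMl// ler_pdivlMl//.
    by move=> h; apply/negP; rewrite -leNgt.
  by move/negP; rewrite -leNgt.
rewrite goodE; have := psd_trace_ge0 psdB; rewrite le_eqVlt => /predU1P[tr0|trgt0].
  rewrite (_ : [set w | _] = set0) ?setC0 ?probability_setT ?lee_fin.
    by rewrite lerBlDr lerDl expR_ge0.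
  apply/seteqP; split=> w //=; rewrite -tr0 !mulr0 => /lt_geF.
  by rewrite sumr_ge0// => i _; exact: Q0.
rewrite probability_setC; last first.
  have mSum : measurable_fun setT (fun w => \sum_i Q i w).
    by apply: measurable_sum => i; exact: has_mean_measurable (Qmu i).
  have := mSum measurableT _ (measurable_itv `]-oo, (k%:R * ((1 - eps) * \tr B))[).
  by rewrite setTI; congr measurable; apply/seteqP; split=> w /=; rewrite in_itv.
rewrite EFinB leeB//.
have := lower_tail trgt0 (_ : 0 < 9) eps0 iF Q0 _ Qmu (fun i => (sP i).1) (fun i => (sP i).2).
rewrite (_ : 2 * 9 = 18 :> R); last by ring.
apply=> // i phi A mphi mA; exact: qform_pair_events.
Qed.

Theorem theorem3p1 (R : realType) (d : measure_display) (T : measurableType d)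
    (P : probability T R) (k nhat ntilde : nat)
    (hk : (1 <= k)%N) (hnhat : (1 <= nhat)%N) (hntilde : (1 <= ntilde)%N)
    (B : 'M[R]_(ntilde * nhat)) (hB : psd B)
    (xtilde : 'I_k -> {RV P >-> ntilde.-tuple R})
    (xhat : 'I_k -> {RV P >-> nhat.-tuple R})
    (hindep : jointly_independent xtilde xhat)
    (hdistr :
       (forall i, standard_gaussian (xtilde i) /\ standard_gaussian (xhat i))
       \/ (forall i, rademacher (xtilde i) /\ rademacher (xhat i)))
    (eps : R) (heps0 : 0 < eps) (heps1 : eps < 1) :
  ((1 - expR (- (k%:R * eps ^+ 2 / 18%:R)))%:E <=
     P [set w | (\tr B <= (1 - eps)^-1 * Est B xtilde xhat w)%R])%E.
Proof.
have gauss n (X : {RV P >-> n.-tuple R}) : standard_gaussian X ->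
    independent_entries X /\ forall j, has_moments P 3 (entry X j).
  move=> [iX XN]; split=> // j; apply: normal_has_moments (XN j).
  exact: measurable_entry.
have signs n (X : {RV P >-> n.-tuple R}) : rademacher X ->
    independent_entries X /\ forall j, has_moments P 1 (entry X j).
  move=> [iX XR]; split=> // j; have [X1 XN1] := XR j.
  exact: sign_has_moments (measurable_entry X j) X1 XN1.
have [h|h] := hdistr.
- by apply: (Est_lower_tail (kappa := 3)) => // i; have [h1 h2] := h i; exact: gauss.
- apply: (Est_lower_tail (kappa := 1)) => // [|i|i]; first by lra.
  + by have [h1 _] := h i; exact: signs.
  + by have [_ h2] := h i; exact: signs.
Qed.
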